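(* Let $q$ be a prime power, $r$ a positive integer, and let $f, g: \mathbb{F}_q^{2r+1} \to \mathbb{F}_q$ be linear bipermutive rules $f(x_0, \dots, x_{2r}) = a_0 x_0 + \cdots + a_{2r} x_{2r}$ and $g(x_0, \dots, x_{2r}) = b_0 x_0 + \cdots + b_{2r} x_{2r}$ (so $a_0, a_{2r}, b_0, b_{2r} \neq 0$). Then for every positive integer $t$ and $m = 2rt$, the squares $L_{\mathcal{F}}$ and $L_{\mathcal{G}}$ of order $q^m$ associated respectively to the linear CA $\mathcal{F} = \langle 2m, r, t, f\rangle: \mathbb{F}_q^{2m} \to \mathbb{F}_q^m$ and $\mathcal{G} = \langle 2m, r, t, g\rangle: \mathbb{F}_q^{2m} \to \mathbb{F}_q^m$ are orthogonal if and only if the polynomials $p_f(X) = a_0 + a_1 X + \cdots + a_{2r} X^{2r}$ and $p_g(X) = b_0 + b_1 X + \cdots + b_{2r} X^{2r}$ in $\mathbb{F}_q[X]$ are relatively prime.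
   Context: Cellular automaton: for positive integers $n, r, t$ with $t < \lfloor n/(2r) \rfloor$ and $f: A^{2r+1} \to A$, the CA $\langle n, r, t, f\rangle$ is the map $F_{t-1} \circ \cdots \circ F_0: A^n \to A^{n-2rt}$, where $F_i: A^{n-2ri} \to A^{n-2r(i+1)}$ sends $x = (x_0, \dots, x_{n-2ri-1})$ to the vector whose $j$-th coordinate is $f(x_j, \dots, x_{j+2r})$ for $j = 0, \dots, n-2r(i+1)-1$. Here $A = \mathbb{F}_q$ and $n = 2m$, so $\mathcal{F}$ maps $\mathbb{F}_q^{2m}$ to $\mathbb{F}_q^{m}$. A linear rule is bipermutive exactly when $a_0 \neq 0$ and $a_{2r} \neq 0$. Associated square: fix a total order on $\mathbb{F}_q^m$ and a monotone bijection $\phi: \mathbb{F}_q^m \to \{1, \dots, q^m\}$ with inverse $\psi$; the square associated to $\mathcal{F}$ is the $q^m \times q^m$ matrix $L_{\mathcal{F}}(i,j) = \phi(\mathcal{F}(\psi(i) \| \psi(j)))$, where $\|$ denotes concatenation of vectors. Two $v \times v$ squares $L_1, L_2$ are orthogonal if $(L_1(i_1,j_1), L_2(i_1,j_1)) \neq (L_1(i_2,j_2), L_2(i_2,j_2))$ whenever $(i_1,j_1) \neq (i_2,j_2)$. *)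

(* Defs.v *)
From HB Require Import structures.
From mathcomp Require Import all_boot all_order all_algebra zify.

Set Implicit Arguments.
Unset Strict Implicit.
Unset Printing Implicit Defensive.

Import GRing.Theory.
Local Open Scope ring_scope.

(* Words of A^n are row vectors 'rV[A]_n, also when the alphabet A carries no
   algebraic structure; the coordinate x_j is [x 0 j]. *)

Lemma ca_bound (n r i : nat) (j : 'I_(n - 2 * r * i.+1)) (k : 'I_(2 * r).+1) :
  (j + k < n - 2 * r * i)%N.
Proof.
have := mulnS (2 * r) i; have := ltn_ord j; have := ltn_ord k; lia.
Qed.

Definition ca_layer (A : Type) (n r : nat) (f : 'rV[A]_(2 * r).+1 -> A)
    (i : nat) (x : 'rV[A]_(n - 2 * r * i)) : 'rV[A]_(n - 2 * r * i.+1) :=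
  \row_j f (\row_k x 0 (Ordinal (ca_bound j k))).

Lemma ca_dim0 (n r : nat) : n = (n - 2 * r * 0)%N.
Proof. by rewrite muln0 subn0. Qed.

(* The composite F_{t-1} o ... o F_0; it is meaningful for t < n %/ (2 * r)
   (outside that range the codomain may degenerate to dimension 0). *)
Fixpoint ca (A : Type) (n r t : nat) (f : 'rV[A]_(2 * r).+1 -> A)
    (x : 'rV[A]_n) : 'rV[A]_(n - 2 * r * t) :=
  match t with
  | 0 => castmx (erefl 1%N, ca_dim0 n r) x
  | t'.+1 => ca_layer f (ca t' f x)
  end.

Lemma half_ca_dim (r t : nat) :
  (2 * r * t + 2 * r * t - 2 * r * t = 2 * r * t)%N.
Proof. exact: addnK. Qed.

(* The automaton <2m, r, t, f> for m = 2rt. The length 2m is written m + m so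
   that its inputs are concatenations [row_mx x y] of two words of length m. *)
Definition half_ca (A : Type) (r t : nat) (f : 'rV[A]_(2 * r).+1 -> A)
    (x : 'rV[A]_(2 * r * t + 2 * r * t)) : 'rV[A]_(2 * r * t) :=
  castmx (erefl 1%N, half_ca_dim r t) (ca t f x).

Arguments half_ca {A} r t f x.

Definition subst_coord (A : Type) (n : nat) (x : 'rV[A]_n) (i : 'I_n) (c : A) :
    'rV[A]_n :=
  \row_k (if k == i then c else x 0 k).

Definition bipermutive (A : Type) (r : nat) (f : 'rV[A]_(2 * r).+1 -> A) : Prop :=
  forall x : 'rV[A]_(2 * r).+1,
    bijective (fun c => f (subst_coord x ord0 c)) /\
    bijective (fun c => f (subst_coord x ord_max c)).

Definition linear_rule (F : fieldType) (r : nat) (a : 'rV[F]_(2 * r).+1)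
    (x : 'rV[F]_(2 * r).+1) : F :=
  \sum_k a 0 k * x 0 k.

Definition rule_poly (F : fieldType) (r : nat) (a : 'rV[F]_(2 * r).+1) :
    {poly F} :=
  \sum_(k < (2 * r).+1) a 0 k *: 'X^k.

Definition is_total_order (T : Type) (le : rel T) : Prop :=
  [/\ reflexive le, antisymmetric le, transitive le & total le].

(* Rows, columns and entries are numbered 0, ..., v - 1 instead of 1, ..., v. *)
Definition ca_square (A : Type) (m v : nat) (phi : 'rV[A]_m -> 'I_v)
    (psi : 'I_v -> 'rV[A]_m) (G : 'rV[A]_(m + m) -> 'rV[A]_m) : 'M['I_v]_v :=
  \matrix_(i, j) phi (G (row_mx (psi i) (psi j))).

Definition orthogonal_squares (v : nat) (L1 L2 : 'M['I_v]_v) : Prop :=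
  forall i1 j1 i2 j2 : 'I_v, (i1, j1) <> (i2, j2) ->
    (L1 i1 j1, L2 i1 j1) <> (L1 i2 j2, L2 i2 j2).

Lemma linear_rule_subst (F : fieldType) (r : nat) (a x : 'rV[F]_(2 * r).+1)
    (i : 'I_(2 * r).+1) (c : F) :
  linear_rule a (subst_coord x i c)
  = a 0 i * c + \sum_(k | k != i) a 0 k * x 0 k.
Proof.
rewrite /linear_rule (bigD1 i) //= mxE eqxx; congr (_ + _).
by apply: eq_bigr => k /negPf nki; rewrite mxE nki.
Qed.

Lemma linear_bipermutiveP (F : fieldType) (r : nat) (a : 'rV[F]_(2 * r).+1) :
  bipermutive (linear_rule a) <-> a 0 ord0 != 0 /\ a 0 ord_max != 0.
Proof.
have coordP (x : 'rV[F]_(2 * r).+1) i :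
    bijective (fun c => linear_rule a (subst_coord x i c)) <-> a 0 i != 0.
  split=> [/bij_inj inj|ai0].
    apply/eqP => ai0; have /eqP := oner_neq0 F; apply.
    by apply: inj; rewrite !linear_rule_subst ai0 !mul0r.
  exists (fun y => (a 0 i)^-1 * (y - \sum_(k | k != i) a 0 k * x 0 k)) => c.
    by rewrite linear_rule_subst addrK mulKf.
  by rewrite linear_rule_subst mulVKf // subrK.
split=> [bip|[a0 am] x]; last by split; apply/coordP.
by have [/coordP ? /coordP ?] := bip 0.
Qed.

(* Main.v *)
(** Read a word [x] of length [n] as the linear functional [X^i |-> x_i] on
    polynomials of degree less than [n]. The automaton then acts as the
    transpose of multiplication by [p_f^t]. The squares are orthogonal iff no
    nonzero functional on polynomials of degree less than [2m] vanishes on all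
    [U p_f^t + V p_g^t] with [U], [V] of degree less than [m]. When [p_f] and
    [p_g] are coprime, Bezout and a Euclidean division reach every polynomial of
    degree less than [2m] in this form; otherwise all such combinations are
    multiples of the nonconstant [d = gcd (p_f^t, p_g^t)], and the top
    coefficient of the remainder modulo [d] is a nonzero functional killing
    them. *)
Require Import Defs.
From HB Require Import structures.
From mathcomp Require Import all_boot all_order all_algebra zify ring.
Import GRing.Theory.
Local Open Scope ring_scope.

Section Pairing.
Context {F : fieldType}.
Implicit Types h p q : {poly F}.

(** Total in [h], so that it is a linear form on all of [{poly F}]. Coefficients from index [n] on
    are ignored, hence the size bounds below. *)
Definition pairing {n} (x : 'rV[F]_n) (h : {poly F}) : F :=
  \sum_(i < n) h`_i * x 0 i.

Lemma pairing_is_linear {n} (x : 'rV[F]_n) : scalar (pairing x).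
Proof.
move=> c h1 h2; rewrite /pairing mulr_sumr -big_split /=.
by apply: eq_bigr => i _; rewrite coefD coefZ mulrDl mulrA.
Qed.

HB.instance Definition _ {n} (x : 'rV[F]_n) :=
  GRing.isLinear.Build F {poly F} F _ (pairing x) (pairing_is_linear x).

Lemma pairingXn {n} (x : 'rV[F]_n) (i : 'I_n) : pairing x 'X^i = x 0 i.
Proof.
rewrite /pairing (bigD1 i) //= coefXn eqxx mul1r big1 ?addr0 // => j /negPf ji.
by rewrite coefXn (inj_eq val_inj) ji mul0r.
Qed.

Lemma pairing_eq0 {n} (x : 'rV[F]_n) :
  (forall h, (size h <= n)%N -> pairing x h = 0) -> x = 0.
Proof.
move=> x0; apply/rowP => i; rewrite mxE -pairingXn x0 //.
by rewrite size_polyXn ltn_ord.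
Qed.

Lemma pairing0l {n} h : pairing (0 : 'rV[F]_n) h = 0.
Proof. by rewrite /pairing big1 // => i _; rewrite mxE mulr0. Qed.

Lemma pairingBl {n} (x y : 'rV[F]_n) h :
  pairing (x - y) h = pairing x h - pairing y h.
Proof.
by rewrite /pairing -sumrB; apply: eq_bigr => i _; rewrite !mxE mulrBr.
Qed.

Lemma pairing_castmx {n n'} (e : n = n') (x : 'rV[F]_n) h :
  pairing (castmx (erefl 1%N, e) x) h = pairing x h.
Proof. by case: n' / e; rewrite castmx_id. Qed.

Lemma poly_sum_monomials {n h} :
  (size h <= n)%N -> h = \sum_(i < n) h`_i *: 'X^i.
Proof.
move=> sh; rewrite -poly_def; apply/polyP => k; rewrite coef_poly.
by case: ltnP => // /(leq_trans sh) /leq_sizeP->.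
Qed.

(** By linearity take [h = 'X^j]: both sides become the sum of the $a_k x_{j+k}$. *)
Lemma pairing_ca_layer {n r} (a : 'rV[F]_(2 * r).+1) (i : nat)
    (x : 'rV[F]_(n - 2 * r * i)) h :
  (size h <= n - 2 * r * i.+1)%N ->
  pairing (ca_layer (linear_rule a) x) h = pairing x (rule_poly a * h).
Proof.
move=> /poly_sum_monomials->.
rewrite mulr_sumr !linear_sum; apply: eq_bigr => j _.
rewrite -scalerAr !linearZ /= pairingXn mxE /linear_rule /rule_poly.
rewrite mulr_suml linear_sum; congr (_ * _); apply: eq_bigr => k _.
rewrite -scalerAl linearZ /= -exprD addnC mxE.
by rewrite (pairingXn _ (Ordinal (ca_bound j k))).
Qed.

Lemma size_rule_poly_le {r} (a : 'rV[F]_(2 * r).+1) :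
  (size (rule_poly a) <= (2 * r).+1)%N.
Proof.
apply/(leq_trans (size_sum _ _ _))/bigmax_leqP => k _.
by rewrite (leq_trans (size_scale_leq _ _)) // size_polyXn ltn_ord.
Qed.

Lemma size_rule_poly {r} (a : 'rV[F]_(2 * r).+1) :
  a 0 ord_max != 0 -> size (rule_poly a) = (2 * r).+1.
Proof.
move=> am; rewrite /rule_poly big_ord_recr /= addrC.
rewrite size_polyDl size_scale ?size_polyXn //.
apply/(leq_ltn_trans (size_sum _ _ _)); rewrite ltnS; apply/bigmax_leqP => k _.
by rewrite (leq_trans (size_scale_leq _ _)) // size_polyXn ltn_ord.
Qed.

Lemma pairing_ca {n r} t (a : 'rV[F]_(2 * r).+1) (x : 'rV[F]_n) h :
  (size h <= n - 2 * r * t)%N ->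
  pairing (ca t (linear_rule a) x) h = pairing x (rule_poly a ^+ t * h).
Proof.
elim: t h => [|t IH] h sh; first by rewrite /= pairing_castmx expr0 mul1r.
(* For nonzero [h] the subtraction [n - 2 * r * t.+1] is not truncated, which the size bound on the
   product needs. *)
have [->|h0] := eqVneq h 0; first by rewrite mulr0 !linear0.
rewrite /= pairing_ca_layer // IH ?exprSr ?mulrA //.
rewrite (leq_trans (size_polyMleq _ _)) //.
have := size_rule_poly_le a; rewrite -size_poly_gt0 in h0.
by move: sh; have := mulnS (2 * r) t; lia.
Qed.

Lemma pairing_half_ca {r} t (a : 'rV[F]_(2 * r).+1) x h :
  (size h <= 2 * r * t)%N ->
  pairing (half_ca r t (linear_rule a) x) h = pairing x (rule_poly a ^+ t * h).
Proof. by move=> sh; rewrite pairing_castmx pairing_ca // addnK. Qed.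

(** Pairings with polynomials of size at most $m$ separate words of length $m$, so additivity is
    inherited from the pairing. *)
Lemma half_ca_linearB {r} t (a : 'rV[F]_(2 * r).+1) x y :
  half_ca r t (linear_rule a) (x - y) =
  half_ca r t (linear_rule a) x - half_ca r t (linear_rule a) y.
Proof.
apply/eqP; rewrite -subr_eq0; apply/eqP/pairing_eq0 => h sh.
by rewrite !pairingBl !pairing_half_ca // pairingBl subrr.
Qed.

Lemma half_ca_eq0 {r} t (a : 'rV[F]_(2 * r).+1) x :
  half_ca r t (linear_rule a) x = 0 <->
  forall h, (size h <= 2 * r * t)%N -> pairing x (rule_poly a ^+ t * h) = 0.
Proof.
split=> [x0 h sh | x0]; first by rewrite -pairing_half_ca // x0 pairing0l.
by apply: pairing_eq0 => h sh; rewrite pairing_half_ca // x0.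
Qed.

Lemma bounded_Bezout {m p q h} :
    size p = m.+1 -> size q = m.+1 -> coprimep p q -> (size h <= m + m)%N ->
  exists u v : {poly F}, [/\ (size u <= m)%N, (size v <= m)%N & h = p * u + q * v].
Proof.
move=> sp sq /Bezout_eq1_coprimepP[[u v] /= uv1] sh.
have q0 : q != 0 by rewrite -size_poly_gt0 sq.
(* Reducing the coefficient of [p] modulo [q] bounds it; the quotient is absorbed into the
   coefficient [w] of [q]. *)
pose s := (h * u) %% q.
have su : (size s <= m)%N by rewrite -ltnS -sq ltn_modp.
set w := (h * u) %/ q * p + h * v.
have hE : h = p * s + q * w.
  by rewrite -[LHS]mulr1 -uv1 mulrDr !mulrA {1}(divp_eq (h * u) q) /s /w; ring.
exists s, w; split=> //.
have [->|w0] := eqVneq w 0; first by rewrite size_poly0.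
have spu := size_polyMleq p s.
(* As [q] has degree [m], this bound forces [size w <= m]. *)
have : (size (q * w)%R <= m + m)%N.
  have -> : q * w = h - p * s by rewrite {1}hE addrC addKr.
  rewrite (leq_trans (size_polyD _ _)) // geq_max sh size_polyN /=.
  by rewrite (leq_trans spu) // sp addSn leq_add2l.
by rewrite size_mul // sq addSn leq_add2l.
Qed.

Lemma coprime_pairing_eq0 {m p q} (x : 'rV[F]_(m + m)) :
    size p = m.+1 -> size q = m.+1 -> coprimep p q ->
    (forall h, (size h <= m)%N -> pairing x (p * h) = 0) ->
    (forall h, (size h <= m)%N -> pairing x (q * h) = 0) ->
  x = 0.
Proof.
move=> sp sq cop xp xq; apply: pairing_eq0 => h.
case/(bounded_Bezout sp sq cop) => u [v [su sv ->]].
by rewrite linearD /= xp // xq // addr0.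
Qed.

(** The index [(size d).-2] is $\deg d - 1$, the largest degree a remainder modulo [d] can have. *)
Definition top_residue n (d : {poly F}) : 'rV[F]_n :=
  \row_(i < n) ('X^i %% d)`_(size d).-2.

Lemma pairing_top_residue {n} d h :
  (size h <= n)%N -> pairing (top_residue n d) h = (h %% d)`_(size d).-2.
Proof.
move=> /poly_sum_monomials hE; rewrite [in RHS]hE.
rewrite (big_morph (fun g => g %% d) (modpD d) (mod0p d)) coef_sum.
by apply: eq_bigr => i _; rewrite modpZl coefZ mxE.
Qed.

(** The monomial of degree $\deg d - 1$ is its own remainder, and the upper bound on [size d] keeps
    it among the [n] coordinates. *)
Lemma top_residue_neq0 {n} (d : {poly F}) :
  (1 < size d)%N -> (size d <= n.+1)%N -> top_residue n d != 0.
Proof.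
move=> d1 dn; have lt_n : ((size d).-2 < n)%N by lia.
apply/eqP => /rowP/(_ (Ordinal lt_n)); rewrite !mxE /= modp_small.
  by rewrite coefXn eqxx; apply/eqP/oner_neq0.
by rewrite size_polyXn; case: (size d) d1 => [|[]].
Qed.

Lemma noncoprime_pairing {m p q} :
    size p = m.+1 -> size q = m.+1 -> ~~ coprimep p q ->
  exists x : 'rV[F]_(m + m),
    [/\ x != 0, forall h, (size h <= m)%N -> pairing x (p * h) = 0
              & forall h, (size h <= m)%N -> pairing x (q * h) = 0].
Proof.
move=> sp sq ncop; set d := gcdp p q.
have p0 : p != 0 by rewrite -size_poly_gt0 sp.
have d0 : d != 0 by rewrite gcdp_eq0 negb_and p0.
have sd : (size d <= m.+1)%N by rewrite -sp dvdp_leq // dvdp_gcdl.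
have d1 : (1 < size d)%N.
  (* [coprimep p q] unfolds to [size d == 1], so what remains is [ncop]. *)
  by rewrite ltn_neqAle eq_sym size_poly_gt0 d0 andbT.
exists (top_residue _ d); split.
- by rewrite top_residue_neq0 // (leq_trans sd) // ltnS leq_addr.
- move=> h sh; rewrite pairing_top_residue.
    by rewrite (modp_eq0P _ _ (dvdp_mulr _ (dvdp_gcdl _ _))) coef0.
  by rewrite (leq_trans (size_polyMleq _ _)) // sp addSn leq_add2l.
- move=> h sh; rewrite pairing_top_residue.
    by rewrite (modp_eq0P _ _ (dvdp_mulr _ (dvdp_gcdr _ _))) coef0.
  by rewrite (leq_trans (size_polyMleq _ _)) // sq addSn leq_add2l.
Qed.

End Pairing.

(** Cutting a word in two halves and numbering each identifies words of length $2m$ with cells of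
    the square; relabelling the entries by the injective [phi] does not affect their equality. *)
Lemma orthogonal_squaresP {A : Type} {m v}
    {phi : 'rV[A]_m -> 'I_v} {psi : 'I_v -> 'rV[A]_m}
    (phiK : cancel phi psi) (psiK : cancel psi phi)
    (G H : 'rV[A]_(m + m) -> 'rV[A]_m) :
  orthogonal_squares (ca_square phi psi G) (ca_square phi psi H) <->
  injective (fun x => (G x, H x)).
Proof.
split=> [orth x y [eG eH] | inj i1 j1 i2 j2 neq [] ].
  pose ix (z : 'rV[A]_(m + m)) := (phi (lsubmx z), phi (rsubmx z)).
  have ixK z : row_mx (psi (ix z).1) (psi (ix z).2) = z.
    by rewrite !phiK hsubmxK.
  have [/(congr1 (fun k => row_mx (psi k.1) (psi k.2)))|/eqP neq] :=
    eqVneq (ix x) (ix y); first by rewrite !ixK.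
  by case: (orth _ _ _ _ neq); rewrite !mxE !ixK eG eH.
rewrite !mxE => /(can_inj phiK) eG /(can_inj phiK) eH; apply: neq.
have /eq_row_mx[] := inj _ _ (congr2 pair eG eH).
by move=> /(can_inj psiK)-> /(can_inj psiK)->.
Qed.

Theorem theorem1 (q : nat) (F : finFieldType) (cardF : #|F| = q)
    (r : nat) (r_gt0 : (0 < r)%N)
    (a b : 'rV[F]_(2 * r).+1)
    (bip_f : bipermutive (linear_rule a)) (bip_g : bipermutive (linear_rule b))
    (t : nat) (t_gt0 : (0 < t)%N)
    (le : rel 'rV[F]_(2 * r * t)) (le_total : is_total_order le)
    (phi : 'rV[F]_(2 * r * t) -> 'I_(q ^ (2 * r * t)))
    (psi : 'I_(q ^ (2 * r * t)) -> 'rV[F]_(2 * r * t))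
    (phi_mono : {homo phi : x y / le x y >-> (x <= y)%N})
    (phiK : cancel phi psi) (psiK : cancel psi phi) :
  orthogonal_squares
    (ca_square phi psi (half_ca r t (linear_rule a)))
    (ca_square phi psi (half_ca r t (linear_rule b)))
  <-> coprimep (rule_poly a) (rule_poly b).
Proof.
have [_ a_max] := (linear_bipermutiveP a).1 bip_f.
have [_ b_max] := (linear_bipermutiveP b).1 bip_g.
have size_exp_rule (c : 'rV[F]_(2 * r).+1) : c 0 ord_max != 0 ->
    size (rule_poly c ^+ t) = (2 * r * t).+1.
  move=> /size_rule_poly sc; rewrite -[(2 * r)%N]/((2 * r).+1.-1) -sc -size_exp.
  by rewrite prednK // size_poly_gt0 expf_neq0 // -size_poly_gt0 sc.
have sp := size_exp_rule a a_max; have sq := size_exp_rule b b_max.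
(* For positive [t], taking powers preserves and reflects coprimality. *)
have -> : coprimep (rule_poly a) (rule_poly b)
        = coprimep (rule_poly a ^+ t) (rule_poly b ^+ t).
  by rewrite coprimep_pexpl ?coprimep_pexpr.
apply: (iff_trans (orthogonal_squaresP phiK psiK _ _)); split.
  move=> inj; apply: contraT => /(noncoprime_pairing sp sq)[x [x0 xp xq]].
  (* Both automata send [x] and the zero word to zero, so injectivity forces [x = 0]. *)
  case/eqP: x0; have z0 c := (half_ca_eq0 t c 0).2 (fun h _ => pairing0l _).
  apply: inj; rewrite !z0.
  by rewrite ((half_ca_eq0 t a x).2 xp) ((half_ca_eq0 t b x).2 xq).
(* By linearity [x - y] lies in both kernels. *)
move=> cop x y [eG eH]; apply/eqP; rewrite -subr_eq0; apply/eqP.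
apply: (coprime_pairing_eq0 _ sp sq cop); apply/half_ca_eq0.
  by rewrite half_ca_linearB eG subrr.
by rewrite half_ca_linearB eH subrr.
Qed.
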